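(* Let $B$ be a locally compact Hausdorff space. The relative Stone--Čech compactification $\beta_B$ is a reflector, i.e. left adjoint to the inclusion functor $I\colon\mathrm{Prop}_B\hookrightarrow\mathrm{Top}_B$: for every $B$-space $(X,r)$, the space $\beta_BX$ with the anchor map $\beta_Br$ is a Hausdorff proper $B$-space, the canonical map $i\colon X\to\beta_BX$ is a $B$-map, and for every Hausdorff proper $B$-space $(X',r')$ and every $B$-map $f\colon X\to X'$ there is a unique $B$-map $f'\colon\beta_BX\to X'$ with $f'\circ i=f$.
   Context: A $B$-space is a topological space $Z$ with a continuous map $r\colon Z\to B$ (anchor map); it is proper if $r$ is proper. A $B$-map $(Z_1,r_1)\to(Z_2,r_2)$ is a continuous map $f$ with $r_2\circ f=r_1$. $\mathrm{Top}_B$ is the category of $B$-spaces and $B$-maps; $\mathrm{Prop}_B$ is its full subcategory of $B$-spaces $(Z,r)$ with $Z$ Hausdorff and $r$ proper. For a $B$-space $(X,r)$, let $H_X\subseteq\mathrm{C_b}(X)$ be the closed linear span of the products $f\cdot(h\circ r)$ with $f\in\mathrm{C_b}(X)$ (bounded continuous functions) and $h\in\mathrm C_0(B)$; this is a commutative C*-algebra. The relative Stone--Čech compactification $\beta_BX$ is the spectrum of $H_X$ (so $H_X\cong\mathrm C_0(\beta_BX)$); $i\colon X\to\beta_BX$ maps $x$ to the character $\varphi\mapsto\varphi(x)$ of $H_X$. The anchor map $\beta_Br\colon\beta_BX\to B$ is the unique continuous map with $\beta_Br\circ i=r$. *)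

(* Defs.v *)
(* Complex numbers: C := (R[i])^o for R : realType
   (mathcomp-real-closed's complex numbers, with the norm topology given by
   mathcomp-analysis' numFieldTopology on the regular-algebra alias ^o). *)
From HB Require Import structures.
From mathcomp Require Import all_boot all_order all_algebra.
From mathcomp Require Import all_classical all_reals all_analysis.
From mathcomp.real_closed Require Import complex.
Import numFieldTopology.Exports.
Import Order.TTheory GRing.Theory Num.Theory.
Unset Printing Implicit Defensive.
Local Open Scope classical_set_scope.
Local Open Scope ring_scope.

Definition Cplx (R : realType) : topologicalType := (R[i])^o.
Definition Cnum (R : realType) : numClosedFieldType := (R[i])^o.

Definition Cb (R : realType) (X : topologicalType) : set (X -> Cnum R) :=
  [set f | continuous (f : X -> Cplx R) /\
           exists M : Cnum R, forall x, `|f x| <= M].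

Definition C0 (R : realType) (B : topologicalType) : set (B -> Cnum R) :=
  [set h | continuous (h : B -> Cplx R) /\
           forall eps : Cnum R, 0 < eps -> compact [set b | eps <= `|h b|]].

Definition Hgen (R : realType) (X B : topologicalType) (r : X -> B)
  : set (X -> Cnum R) :=
  [set g | exists f h, Cb R X f /\ C0 R B h /\ g = (fun x => f x * h (r x))].

Definition Hspan (R : realType) (X B : topologicalType) (r : X -> B)
  : set (X -> Cnum R) :=
  [set g | exists (n : nat) (c : 'I_n -> Cnum R) (gs : 'I_n -> X -> Cnum R),
           (forall k, Hgen R X B r (gs k)) /\
           g = (fun x => \sum_(k < n) c k * gs k x)].

Definition HX (R : realType) (X B : topologicalType) (r : X -> B)
  : set (X -> Cnum R) :=
  [set g | Cb R X g /\
           forall eps : Cnum R, 0 < eps ->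
             exists2 s, Hspan R X B r s & forall x, `|g x - s x| <= eps].

(** Characters of H_X (nonzero algebra homomorphisms H_X -> C).  A character
    is represented by a functional on all of X -> C which is normalised to be
    0 outside H_X, so that it is determined by its restriction to H_X. *)
Definition is_char (R : realType) (X B : topologicalType) (r : X -> B)
  (phi : (X -> Cnum R) -> Cnum R) : Prop :=
  [/\ forall (a : Cnum R) g h, HX R X B r g -> HX R X B r h ->
        phi (fun x => a * g x + h x) = a * phi g + phi h,
      forall g h, HX R X B r g -> HX R X B r h ->
        phi (fun x => g x * h x) = phi g * phi h,
      exists2 g, HX R X B r g & phi g != 0
    & forall g, ~ HX R X B r g -> phi g = 0].

Definition char_space (R : realType) (X B : topologicalType) (r : X -> B) :=
  {phi : (X -> Cnum R) -> Cnum R | is_char R X B r phi}.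
HB.instance Definition _ (R : realType) (X B : topologicalType) (r : X -> B) :=
  gen_eqMixin (char_space R X B r).
HB.instance Definition _ (R : realType) (X B : topologicalType) (r : X -> B) :=
  gen_choiceMixin (char_space R X B r).

(** The spectrum of H_X with the weak-* (Gelfand) topology: the initial
    topology for the pointwise-convergence topology on functionals. *)
Definition betaB (R : realType) (X B : topologicalType) (r : X -> B) :=
  initial_topology
    (fun phi : char_space R X B r => (sval phi : {ptws (X -> Cnum R) -> Cplx R})).

Definition proper_map (S T : topologicalType) (f : S -> T) : Prop :=
  forall K : set T, compact K -> compact (f @^-1` K).
Arguments proper_map {S T} f.

(* Main.v *)
(* [H_X] consists of the [g] in [C_b(X)] that are small outside the preimages of
   compact subsets of [B].  Every character of [H_X] is a pointwise limit of
   evaluations along a filter on [X], so [i] has dense image.  Let [f : X -> X']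
   be a [B]-map to a Hausdorff proper [B]-space.  The filter of a character
   [phi] eventually lies over a compact subset of [B], so its image under [f]
   clusters at some [y], and [k y = phi (k o f)] for all [k] in [C_0(X')].
   Since these [k] separate points from closed sets, [f' phi = y] defines a
   continuous extension of [f]; for [X' = B] it is the anchor map.  The anchor
   map is proper because ultrafilters of characters converge pointwise, and over
   a compact [K] the limit is nonzero on [h o r], where [h = 1] on [K]. *)
Require Import Defs.
From HB Require Import structures.
From mathcomp Require Import all_boot all_order all_algebra.
From mathcomp Require Import all_classical all_reals all_analysis.
From mathcomp.real_closed Require Import complex.
From mathcomp Require Import ring.
Import numFieldTopology.Exports.
Import Order.TTheory GRing.Theory Num.Theory.
Import numFieldNormedType.Exports.
Local Open Scope classical_set_scope.
Local Open Scope ring_scope.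

(** * Urysohn functions on locally compact Hausdorff spaces *)

Lemma preimage_some_compact (B : topologicalType) (S : set B) :
  compact (Some @` S : set (one_point_compactification B)) -> compact S.
Proof.
move=> cS F PF FS.
have [|_ [[s Ss <-] cls]] := cS ((Some : B -> one_point_compactification B) @ F) _.
  by rewrite /= /nbhs /=; apply: (@filterS _ F _ S) => // x Sx; exists x.
exists s; split => // A N FA Ns.
have FA' : ((Some : B -> one_point_compactification B) @ F) (Some @` A).
  by rewrite /nbhs /=; apply: (@filterS _ F _ A) => // x Ax; exists x.
have [_ [[a Aa <-] [b Nb [ba]]]] :=
  cls _ _ FA' (one_point_compactification_some_nbhs _ _ Ns).
by exists a; split=> //; rewrite -ba.
Qed.

Lemma continuous_real_complex (R : realType) (T : topologicalType) (f : T -> R) :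
  continuous f -> continuous ((fun x => (f x)%:C%C) : T -> Cplx R).
Proof.
move=> cf x; apply/(@cvgrPdist_lt _ (R[i])^o) => e e0.
(* A positive element of [R[i]] is real, so its real part serves as the tolerance in [R]. *)
have er : (complex.Re e)%:C%C = e by apply: RRe_real; exact: gtr0_real.
have e0' : 0 < complex.Re e by rewrite -ltcR er.
move/cvgrPdist_lt: (cf x) => /(_ _ e0'); apply: filterS => y.
by rewrite -rmorphB /= normc_def /= expr0n /= addr0 sqrtr_sqr -er ltcR.
Qed.

(** Normality of the one-point compactification gives the separating function. Adding the point at
    infinity to the complement of [U] forces [h] to vanish at infinity. *)
Lemma C0_urysohn (R : realType) (B : topologicalType) (K U : set B) :
  hausdorff_space B -> locally_compact [set: B] ->
  compact K -> open U -> K `<=` U ->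
  exists h : B -> Cnum R,
    [/\ Cb R B h, C0 R B h, forall b, 0 <= h b <= 1, forall b, K b -> h b = 1
      & forall b, ~ U b -> h b = 0].
Proof.
move=> hB lB cK oU KU.
have hO := one_point_compactification_hausdorff lB hB.
have cO := @one_point_compactification_compact B.
have nO := compact_normal hO cO.
pose A : set (one_point_compactification B) := ~` (Some @` U).
pose K' : set (one_point_compactification B) := Some @` K.
have clA : closed A.
  by apply: open_closedC; exact: one_point_compactification_open_some.
have clK : closed K'.
  apply: compact_closed => //; apply: continuous_compact => //.
  apply: continuous_subspaceT.
  exact: one_point_compactification_some_continuous.
have AK : A `&` K' = set0.
  by rewrite -subset0 => x [nU [k Kk kx]]; apply: nU; exists k => //; exact: KU.
have /(@uniform_separatorP _ R)[f [cf f01 fA fK]] :=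
  (@normal_separatorP R _).1 nO _ _ clA clK AK.
have f01' b : 0 <= f b <= 1.
  by have := f01 _ (imageT f b); rewrite /= in_itv.
have cfS : continuous (fun b : B => f (Some b)).
  move=> b; apply: (@continuous_comp B (one_point_compactification B) R Some f).
    exact: one_point_compactification_some_continuous.
  exact: cf.
have nf b : `|(f b)%:C%C| = (f b)%:C%C :> R[i].
  by rewrite ger0_norm // ler0c; case/andP: (f01' b).
exists (fun b => (f (Some b))%:C%C); split.
- split; first exact: continuous_real_complex.
  by exists 1 => b; rewrite nf -[1]/(1%:C%C) lecR; case/andP: (f01' (Some b)).
- split; first exact: continuous_real_complex.
  move=> e e0; have er : (complex.Re e)%:C%C = e by apply: RRe_real; exact: gtr0_real.
  have e0' : 0 < complex.Re e by rewrite -ltcR er.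
  apply: preimage_some_compact.
  (* Since [f None = 0 < e], the superlevel set avoids infinity, and it is closed in a compact
     space. *)
  have -> : [set Some b | b in [set b | e <= `|(f (Some b))%:C%C| ]] =
     f @^-1` [set x | complex.Re e <= x].
    apply/seteqP; split => [_ /= [b + <-]|[b|] /=].
    - by rewrite /= nf -{1}er lecR.
    - by move=> h; exists b => //=; rewrite nf -er lecR.
    - have -> : f None = 0 by apply: fA; exists None => // -[].
      by rewrite leNgt e0'.
  apply: (subclosed_compact _ cO) => //.
  by apply: closed_comp; [move=> x _; exact: cf|exact: closed_ge].
- by move=> b; rewrite ler0c -[1]/(1%:C%C) lecR; exact: f01'.
- by move=> b Kb; rewrite (fK (f (Some b))) //; exists (Some b) => //; exists b.
- move=> b Ub; rewrite (fA (f (Some b))) //; exists (Some b) => //.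
  by move=> [c Uc [cb]]; apply: Ub; rewrite -cb.
Qed.

(** * Continuous and bounded complex-valued functions *)

Lemma continuous_CplxD (R : realType) (T : topologicalType) (f g : T -> Cnum R) :
  continuous (f : T -> Cplx R) -> continuous (g : T -> Cplx R) ->
  continuous ((fun x => f x + g x) : T -> Cplx R).
Proof.
by move=> cf cg x; exact: (@cvgD _ (R[i])^o _ _ _ _ _ _ _ (cf x) (cg x)).
Qed.

Lemma continuous_CplxM (R : realType) (T : topologicalType) (f g : T -> Cnum R) :
  continuous (f : T -> Cplx R) -> continuous (g : T -> Cplx R) ->
  continuous ((fun x => f x * g x) : T -> Cplx R).
Proof.
by move=> cf cg x; exact: (@cvgM (R[i])^o _ _ _ _ _ _ _ (cf x) (cg x)).
Qed.

Lemma continuous_CplxV (R : realType) (T : topologicalType) (f : T -> Cnum R) :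
  continuous (f : T -> Cplx R) -> (forall x, f x != 0) ->
  continuous ((fun x => (f x)^-1) : T -> Cplx R).
Proof.
by move=> cf f0 x; exact: (@cvgV (R[i])^o _ _ _ _ _ (f0 x) (cf x)).
Qed.

Lemma continuous_CplxJ (R : realType) (T : topologicalType) (f : T -> Cnum R) :
  continuous (f : T -> Cplx R) -> continuous ((fun x => (f x)^*) : T -> Cplx R).
Proof.
move=> cf x; apply/(@cvgrPdist_lt _ (R[i])^o) => e e0.
move/(@cvgrPdist_lt _ (R[i])^o): (cf x) => /(_ _ e0); apply: filterS => y.
by rewrite -rmorphB /= norm_conjC.
Qed.

Lemma Cplx_hausdorff (R : realType) : hausdorff_space (Cplx R).
Proof. exact: (@norm_hausdorff _ (R[i])^o). Qed.

Lemma Cb_cst (R : realType) (X : topologicalType) (a : Cnum R) :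
  Cb R X (fun=> a).
Proof. by split; [move=> x; exact: cvg_cst|exists `|a|]. Qed.

Lemma CbD (R : realType) (X : topologicalType) (f g : X -> Cnum R) :
  Cb R X f -> Cb R X g -> Cb R X (fun x => f x + g x).
Proof.
move=> [cf [M fM]] [cg [N gN]]; split; first exact: continuous_CplxD.
by exists (M + N) => x; apply: le_trans (ler_normD _ _) _; exact: lerD.
Qed.

Lemma CbM (R : realType) (X : topologicalType) (f g : X -> Cnum R) :
  Cb R X f -> Cb R X g -> Cb R X (fun x => f x * g x).
Proof.
move=> [cf [M fM]] [cg [N gN]]; split; first exact: continuous_CplxM.
by exists (M * N) => x; rewrite normrM ler_pM.
Qed.

Lemma CbJ (R : realType) (X : topologicalType) (f : X -> Cnum R) :
  Cb R X f -> Cb R X (fun x => (f x)^*).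
Proof.
move=> [cf [M fM]]; split; first exact: continuous_CplxJ.
by exists M => x; rewrite norm_conjC.
Qed.

(** * [H_X] as the bounded continuous functions vanishing at infinity over [B] *)

(** Compactness is asked in [B], not in [X]: along a single fibre of [r] the function need not
    decay. *)
Definition vanishes (R : realType) (X B : topologicalType) (r : X -> B)
    (g : X -> Cnum R) :=
  forall eps : Cnum R, 0 < eps ->
    exists2 K : set B, compact K & forall x, ~ K (r x) -> `|g x| <= eps.

Lemma vanishesD (R : realType) (X B : topologicalType) (r : X -> B)
    (f g : X -> Cnum R) :
  vanishes R X B r f -> vanishes R X B r g ->
  vanishes R X B r (fun x => f x + g x).
Proof.
move=> vf vg e e0; have e20 : 0 < e / 2 by rewrite divr_gt0.
have [K cK fK] := vf _ e20; have [L cL gL] := vg _ e20.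
exists (K `|` L); first exact: compactU.
move=> x /not_orP[nK nL]; apply: le_trans (ler_normD _ _) _.
by rewrite (splitr e) lerD ?fK ?gL.
Qed.

Lemma vanishesM (R : realType) (X B : topologicalType) (r : X -> B)
    (f g : X -> Cnum R) :
  Cb R X f -> vanishes R X B r g -> vanishes R X B r (fun x => f x * g x).
Proof.
move=> [_ [M fM]] vg e e0.
(* Over an empty [X] the bound [M] can be any complex number; a point of [X] shows that [0 <= M]. *)
have [x0|nX] := pselect (exists x : X, True); last first.
  by exists set0; [exact: compact0|move=> x; case: nX; exists x].
have M0 : 0 <= M by case: x0 => x _; exact: le_trans (fM x).
have M10 : 0 < M + 1 by rewrite ltr_wpDl.
have [K cK gK] := vg (e / (M + 1)) (divr_gt0 e0 M10).
exists K => // x nK; rewrite normrM.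
rewrite -[leRHS](divfK (lt0r_neq0 M10)) mulrC ler_pM ?gK//.
by apply: le_trans (fM x) _; rewrite lerDl.
Qed.

(** A generator [f (h o r)] is small outside a compact superlevel set of [h], and this smallness
    survives linear combinations and uniform limits. Conversely, a cutoff [h] equal to 1 on [K]
    makes the single generator [g (h o r)] uniformly close to [g]. *)
Lemma HXP (R : realType) (X B : topologicalType) (r : X -> B)
    (g : X -> Cnum R) :
  hausdorff_space B -> locally_compact [set: B] -> continuous r ->
  HX R X B r g <-> Cb R X g /\ vanishes R X B r g.
Proof.
move=> hB lB cr; split=> [[Cg gs]|[Cg vg]].
  split => // e e0; have e20 : 0 < e / 2 by rewrite divr_gt0.
  have [s [n [c [gn [Hg sE]]]] gsn] := gs _ e20; subst s.
  have /(_ _ e20)[K cK sK] : vanishes R X B r (fun x => \sum_(k < n) c k * gn k x).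
    elim: n c gn Hg {gsn} => [|n IH] c gn Hg.
      move=> d d0; exists set0; first exact: compact0.
      by move=> x _; rewrite big_ord0 normr0 ltW.
    under eq_fun do rewrite big_ord_recr /=.
    apply: vanishesD; first by apply: IH => k; exact: Hg.
    apply: vanishesM; first exact: Cb_cst.
    have [f [h [Cf [[ch hc] ->]]]] := Hg ord_max.
    apply: vanishesM => // d d0; exists [set b | d <= `|h b| ]; first exact: hc.
    move=> x /negP; rewrite -real_ltNge //; first exact: ltW.
    exact: gtr0_real.
  exists K => // x nK; rewrite -(subrK (\sum_(k < n) c k * gn k x) (g x)).
  by apply: le_trans (ler_normD _ _) _; rewrite [leRHS]splitr lerD ?sK.
split => // e e0; have [K cK gK] := vg _ e0.
have [h [_ Ch h01 h1 _]] :=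
  C0_urysohn R B K setT hB lB cK openT (fun _ _ => I).
exists (fun x => g x * h (r x)).
  exists 1%N, (fun=> 1), (fun _ x => g x * h (r x)); split.
    by move=> _; exists g, h.
  by apply/funext => x; rewrite big_ord1 mul1r.
move=> x; rewrite -[X in X - _]mulr1 -mulrBr normrM.
have [Kr|nKr] := pselect (K (r x)); first by rewrite h1// subrr normr0 mulr0 ltW.
rewrite -[leRHS]mulr1 ler_pM ?gK//.
have /andP[h0 h1'] := h01 (r x).
by rewrite ger0_norm ?subr_ge0// lerBlDr lerDl.
Qed.

(** * Ultrafilters and bounded sets of complex numbers *)

Lemma fmap_ultra (T U : Type) (f : T -> U) (F : set_system T) :
  UltraFilter F -> UltraFilter (f @ F).
Proof.
move=> UF; split; first exact: fmap_proper_filter.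
move=> G PG FG; apply/seteqP; split => // A GA.
have [//|FnA] := in_ultra_setVsetC (f @^-1` A) UF.
have GnA : G (~` A) by exact: FG.
by have [u []] := filter_ex (filterI GA GnA).
Qed.

(** The disc lies in a square, the continuous image of a product of two segments. This will supply
    limits of character values along ultrafilters. *)
Lemma Cplx_disc_compact (R : realType) (M : Cnum R) : exists D : set (Cplx R),
  compact D /\ forall z : Cnum R, `|z| <= M -> D z.
Proof.
pose m := complex.Re M.
pose q (p : R * R) : Cnum R := (p.1)%:C%C + 'i%C * (p.2)%:C%C.
exists (q @` (`[- m, m] `*` `[- m, m])); split.
  apply: continuous_compact; last by apply: compact_setX; exact: segment_compact.
  apply: continuous_subspaceT; apply: continuous_CplxD.
    by apply: continuous_real_complex => p; exact: cvg_fst.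
  apply: continuous_CplxM; first by case: (Cb_cst R (R * R)%type 'i%C).
  by apply: continuous_real_complex => p; exact: cvg_snd.
move=> z zM; exists (complex.Re z, complex.Im z); last by rewrite /q [RHS]complexE.
have nz : complex.Re `|z| <= m by move: zM; rewrite lecE => /andP[].
have nE : `|z| = (complex.Re `|z|)%:C%C by rewrite normc_def.
have Rz : `|complex.Re z| <= m.
  by rewrite (le_trans _ nz)// -lecR -nE normc_ge_Re.
have Iz : `|complex.Im z| <= m.
  rewrite (le_trans _ nz)// -lecR -nE.
  by have := normc_ge_Re (z * 'i%C); rewrite ReiNIm normrN normrM complexiE normCi mulr1.
by rewrite /= !in_itv /= -!ler_norml.
Qed.

(** * Algebraic operations on [H_X] *)

Section RelativeBeta.
Context (R : realType) (B X : topologicalType) (r : X -> B).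
Context (hB : hausdorff_space B) (lB : locally_compact [set: B]).
Context (cr : continuous r).
Local Notation C := (Cnum R).
Local Notation H := (HX R X B r).
Local Notation beta := (betaB R X B r).

Lemma HXD (g h : X -> C) : H g -> H h -> H (fun x => g x + h x).
Proof.
move=> /(HXP _ _ _ _ _ hB lB cr)[Cg vg] /(HXP _ _ _ _ _ hB lB cr)[Ch vh].
by apply/HXP => //; split; [exact: CbD|exact: vanishesD].
Qed.

(** This ideal property in [C_b(X)] later keeps quasi-inverses inside [H_X]. *)
Lemma HXM (f g : X -> C) : Cb R X f -> H g -> H (fun x => f x * g x).
Proof.
move=> Cf /(HXP _ _ _ _ _ hB lB cr)[Cg vg].
by apply/HXP => //; split; [exact: CbM|exact: vanishesM].
Qed.

Lemma HXZ (a : C) (g : X -> C) : H g -> H (fun x => a * g x).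
Proof. by apply: HXM; exact: Cb_cst. Qed.

Lemma HXJ (g : X -> C) : H g -> H (fun x => (g x)^*).
Proof.
move=> /(HXP _ _ _ _ _ hB lB cr)[Cg vg]; apply/HXP => //.
split; first exact: CbJ.
by move=> e /vg[K cK gK]; exists K => // x /gK; rewrite norm_conjC.
Qed.

Lemma HX_Cb (g : X -> C) : H g -> Cb R X g.
Proof. by case. Qed.

(** The compact subset of [B] for [e] is the image under [s] of the superlevel set of [k]. With
    [s = id] this covers [h o r]; with a proper [s] it supplies the test functions [k o f]. *)
Lemma HX_comp (Y : topologicalType) (s : Y -> B) (f : X -> Y) (k : Y -> C) :
  continuous s -> continuous f -> s \o f = r -> Cb R Y k -> C0 R Y k ->
  H (k \o f).
Proof.
move=> cs cf sf [ck [M kM]] [_ k0]; apply/HXP => //; split.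
  split; last by exists M => x; exact: kM.
  by move=> x; apply: (@continuous_comp X Y (Cplx R) f k); [exact: cf|exact: ck].
move=> e e0; exists (s @` [set y | e <= `|k y| ]).
  by apply: continuous_compact; [exact: continuous_subspaceT|exact: k0].
move=> x nx; rewrite real_leNgt ?realE ?normr_ge0 ?(ltW e0)//; apply/negP => /ltW ex; apply: nx.
by rewrite -sf; exists (f x).
Qed.

(** * Characters as limits of point evaluations *)

Section Character.
Variable phi : char_space R X B r.

Lemma charD (g h : X -> C) : H g -> H h ->
  sval phi (fun x => g x + h x) = sval phi g + sval phi h.
Proof.
move=> Hg Hh; have [lin _ _ _] := svalP phi.
rewrite -[in RHS](mul1r (sval phi g)) -lin//; congr (sval phi _).
by apply/funext => x; rewrite mul1r.
Qed.

Lemma charM (g h : X -> C) : H g -> H h ->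
  sval phi (fun x => g x * h x) = sval phi g * sval phi h.
Proof. by have [_ mul _ _] := svalP phi; exact: mul. Qed.

Lemma char0 : sval phi (fun=> 0) = 0.
Proof.
have [lin _ [e He _] _] := svalP phi.
have -> : (fun=> 0) = (fun x => -1 * e x + e x).
  by apply/funext => x; rewrite mulN1r addNr.
by rewrite lin// mulN1r addNr.
Qed.

Lemma charZ (a : C) (g : X -> C) : H g ->
  sval phi (fun x => a * g x) = a * sval phi g.
Proof.
move=> Hg; have [lin _ [e He _] _] := svalP phi.
have H0 : H (fun=> 0).
  have -> : (fun=> 0) = (fun x => 0 * e x) by apply/funext => x; rewrite mul0r.
  exact: HXZ.
rewrite -[RHS]addr0 -char0 -lin//; congr (sval phi _).
by apply/funext => x; rewrite addr0.
Qed.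

(** [H_X] need not contain the constant 1; such an [e] replaces it. *)
Lemma char_local_unit : exists2 e, H e & sval phi e = 1.
Proof.
have [_ _ [g Hg g0] _] := svalP phi.
by exists (fun x => (sval phi g)^-1 * g x); [exact: HXZ|rewrite charZ// mulVf].
Qed.

(* Otherwise [1 + w], where [w = g + |1 - e|^2 - 1] lies in [H_X], is bounded
   below by [d], so it has an inverse [1 + v] with [v] in [H_X]; but
   [phi w = -1], so applying [phi] to [w + v + w v = 0] gives [-1 = 0]. *)
Lemma char_inf0 (e g : X -> C) (d : C) : H e -> sval phi e = 1 ->
  H g -> sval phi g = 0 -> (forall x, 0 <= g x) -> 0 < d ->
  exists x, g x + `|1 - e x| ^+ 2 < d.
Proof.
move=> He e1 Hg phig g0 d0; apply: contrapT => /forallNP nd.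
pose u x := e x * (e x)^* + -1 * (e x + (e x)^*).
have HeJ := HXJ _ He.
have HeeJ := HXM _ _ (HX_Cb _ He) HeJ.
have HeD := HXD _ _ He HeJ.
have Hu : H u by apply: HXD => //; exact: HXZ.
pose w x := g x + u x.
have Hw : H w by exact: HXD.
have wE x : 1 + w x = g x + `|1 - e x| ^+ 2.
  by rewrite normCK rmorphB /= rmorph1 /w /u; ring.
have dw x : d <= 1 + w x.
  rewrite wE real_leNgt; [exact/negP/nd|exact: gtr0_real|].
  by rewrite ger0_real// addr_ge0 ?exprn_ge0.
have w0 x : 1 + w x != 0 by rewrite lt0r_neq0// (lt_le_trans d0).
(* As [phi e = 1], the value of [phi] at the conjugate of [e] occurs with both signs and cancels. *)
have phiw : sval phi w = -1.
  rewrite charD// phig add0r charD//; last exact: HXZ.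
  by rewrite charM// charZ// charD// e1; ring.
pose v x := - (1 + w x)^-1 * w x.
have Hv : H v.
  apply: HXM => //; split.
    have -> : (fun x => - (1 + w x)^-1) = (fun x => -1 * (1 + w x)^-1).
      by apply/funext => x; rewrite mulN1r.
    apply: continuous_CplxM; first by case: (Cb_cst R X (-1)).
    apply: continuous_CplxV => //; apply: continuous_CplxD; first by case: (Cb_cst R X 1).
    by case: (HX_Cb _ Hw).
  exists d^-1 => x; rewrite normrN normfV lef_pV2 ?posrE ?normr_gt0//.
  by rewrite ger0_norm// (le_trans (ltW d0)).
have := char0.
have -> : (fun=> 0) = (fun x => w x + (v x + w x * v x)).
  by apply/funext => x; rewrite /v; field.
have Hwv := HXM _ _ (HX_Cb _ Hw) Hv.
rewrite (charD w (fun x => v x + w x * v x))//; last exact: HXD.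
rewrite (charD v)// (charM w)// phiw mulN1r subrr addr0 => /eqP.
by rewrite oppr_eq0 oner_eq0.
Qed.

(* The sets below form a filter base without passing to finite intersections:
   a finite family of nonnegative [g] with [phi g = 0] is dominated by its sum. *)
Lemma char_limit : exists G : set_system X, ProperFilter G /\
  forall g, H g -> (g : X -> Cplx R) @ G --> (sval phi g : Cplx R).
Proof.
have [e He e1] := char_local_unit.
pose D := [set gd : (X -> C) * C | [/\ H gd.1, sval phi gd.1 = 0,
  forall x, 0 <= gd.1 x & 0 < gd.2]].
pose S (gd : (X -> C) * C) := [set x | gd.1 x + `|1 - e x| ^+ 2 < gd.2].
have PG : ProperFilter (filter_from D S).
  apply: filter_from_proper.
    apply: filter_from_filter.
      exists (fun x => 0 * e x, 1); split => //=.
      - exact: HXZ.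
      - by rewrite charZ// mul0r.
      - by move=> x; rewrite mul0r.
    move=> [g d] [h d'] [/= Hg phig g0 d0] [/= Hh phih h0 d'0].
    (* Positive elements of [R[i]] are real, hence comparable, so the smaller bound can be taken. *)
    have dd : (d <= d') || (d' <= d) by apply: real_leVge; exact: gtr0_real.
    exists (fun x => g x + h x, if d <= d' then d else d'); first split => /=.
    - exact: HXD.
    - by rewrite charD// phig phih addr0.
    - by move=> x; rewrite addr_ge0.
    - by case: ifP.
    move=> x; rewrite /S /= => lt.
    have [md md'] : (if d <= d' then d else d') <= d /\
        (if d <= d' then d else d') <= d'.
      by move: dd; case: ifP => //= _.
    split; [apply: le_lt_trans (lt_le_trans lt md)|apply: le_lt_trans (lt_le_trans lt md')].
      by rewrite lerD2r lerDl.
    by rewrite lerD2r lerDr.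
  by move=> [g d] [/= Hg phig g0 d0]; exact: char_inf0.
exists (filter_from D S); split => // g Hg; apply/(@cvgrPdist_lt _ (R[i])^o) => eps eps0.
(* With [m = g - a e] in the kernel of [phi], the base set of [|m|^2] and [t^2] bounds both [|m|]
   and [|1 - e|] by [t]. As [a - g = a (1 - e) - m], the error is below [|a| t + t = eps]. *)
pose a : C := sval phi g.
pose t : C := eps / (1 + `|a|).
have a0 : 0 < 1 + `|a| by rewrite ltr_pwDl.
have t0 : 0 < t by rewrite divr_gt0.
pose m x := g x + - a * e x.
have Hm : H m by apply: HXD => //; exact: HXZ.
exists (fun x => m x * (m x)^*, t ^+ 2).
  split => /=.
  - by apply: HXM; [exact: HX_Cb|exact: HXJ].
  - rewrite charM//; last exact: HXJ.
    by rewrite charD//; [rewrite charZ// e1 mulr1 subrr mul0r|exact: HXZ].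
  - by move=> x; rewrite mul_conjC_ge0.
  - by rewrite exprn_gt0.
move=> x; rewrite /S /= -normCK => lt.
have mt : `|m x| < t.
  rewrite -(@ltr_pXn2r _ 2)// ?nnegrE ?(ltW t0)//.
  by apply: le_lt_trans lt; rewrite lerDl exprn_ge0.
have et : `|1 - e x| < t.
  rewrite -(@ltr_pXn2r _ 2)// ?nnegrE ?(ltW t0)//.
  by apply: le_lt_trans lt; rewrite lerDr exprn_ge0.
have -> : (sval phi g : (R[i])^o) - g x = a * (1 - e x) - m x.
  by rewrite /m -/a; ring.
have -> : eps = `|a| * t + t by rewrite /t; field; exact: lt0r_neq0.
apply: le_lt_trans (ler_normB _ _) _; rewrite normrM.
by rewrite ler_ltD// ler_wpM2l// ltW.
Qed.

End Character.

(** * Topology of the spectrum *)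

Lemma beta_eval_continuous (g : X -> C) :
  continuous (fun phi : beta => sval phi g : Cplx R).
Proof.
move=> phi; apply: (@continuous_comp beta {ptws (X -> C) -> Cplx R} (Cplx R)
  (fun p : char_space R X B r => sval p) (fun p => p g)).
  exact: initial_continuous.
exact: (@proj_continuous (X -> C) (fun=> Cplx R) g).
Qed.

(** Testing on [H_X] suffices because off [H_X] every character is normalised to 0, so those
    coordinates are constant. *)
Lemma beta_cvg (F : set_system beta) (phi : beta) : Filter F ->
  (forall g, H g ->
    (fun psi : beta => sval psi g : Cplx R) @ F --> (sval phi g : Cplx R)) ->
  F --> phi.
Proof.
move=> FF Fg U [/= _ [[A oA <-] Aphi] AU].
apply: filterS AU _.
have : ((fun p : beta => sval p) : beta -> {ptws (X -> C) -> Cplx R}) @ F -->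
    (sval phi : {ptws (X -> C) -> Cplx R}).
  apply/cvg_sup => g; apply/cvg_image => //.
    by apply/seteqP; split => // y _; exists (fun=> y).
  have Fg' : (fun psi : beta => sval psi g : Cplx R) @ F -->
      (sval phi g : Cplx R).
    have [Hg|nHg] := pselect (H g); first exact: Fg.
    have -> : (fun psi : beta => sval psi g : Cplx R) = (fun=> 0).
      by apply/funext => psi; have [_ _ _ ->] := svalP psi.
    have [_ _ _ ->//] := svalP phi.
    exact: cvg_cst.
  move=> V /Fg' FV; exists ((fun f : (X -> C) -> Cplx R => f g) @^-1` V) => //.
  by apply: image_preimage; apply/seteqP; split => // y _; exists (fun=> y).
by apply; apply: open_nbhs_nbhs.
Qed.

Lemma beta_inj (phi psi : beta) :
  (forall g, H g -> sval phi g = sval psi g) -> phi = psi.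
Proof.
move: phi psi => [p cp] [q cq] /= e.
suff pq : p = q.
  by move: cp cq; rewrite pq => cp cq; congr exist; exact: Prop_irrelevance.
apply/funext => g; have [Hg|nHg] := pselect (H g); first exact: e.
by have [_ _ _ ->//] := cp; have [_ _ _ ->//] := cq.
Qed.

Lemma beta_hausdorff : hausdorff_space beta.
Proof.
move=> phi psi cl; apply: beta_inj => g _; apply: (@Cplx_hausdorff R).
move=> U V /beta_eval_continuous nU /beta_eval_continuous nV.
by have [p [Up Vp]] := cl _ _ nU nV; exists (sval p g).
Qed.

(** * The canonical map and its dense image *)

(** The case distinction enforces the normalisation off [H_X]. The evaluation is nonzero on [h o r]
    for a cutoff [h] with [h (r x) = 1]. *)
Lemma point_is_char (x : X) :
  is_char R X B r (fun g => if `[< H g >] then g x else 0).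
Proof.
split.
- move=> a g h Hg Hh; rewrite !asboolT//.
  by apply: HXD => //; exact: HXZ.
- move=> g h Hg Hh; rewrite !asboolT//.
  by apply: HXM => //; exact: HX_Cb.
- have [h [Cbh C0h _ h1 _]] :=
    C0_urysohn R B [set r x] setT hB lB (@compact_set1 _ _) openT (fun _ _ => I).
  have Hh : H (h \o r).
    by apply: (@HX_comp B id r h) => //; first by move=> b; exact: cvg_id.
  by exists (h \o r) => //; rewrite asboolT//= h1// oner_eq0.
- by move=> g nHg; rewrite asboolF.
Qed.

Definition beta_unit (x : X) : beta := exist _ _ (point_is_char x).

Lemma beta_unitE (x : X) (g : X -> C) : H g -> sval (beta_unit x) g = g x.
Proof. by move=> Hg; rewrite /= asboolT. Qed.

Lemma beta_unit_continuous : continuous beta_unit.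
Proof.
move=> x; apply: (@beta_cvg (beta_unit @ nbhs x)) => g Hg.
rewrite beta_unitE//.
have -> : (fun psi : beta => sval psi g) @ (beta_unit @ nbhs x) =
    (g : X -> Cplx R) @ nbhs x.
  rewrite -[LHS]/((fun y => sval (beta_unit y) g) @ nbhs x).
  by under eq_fun do rewrite beta_unitE//.
by have [[cg _] _] := Hg; exact: cg.
Qed.

Lemma beta_unit_dense (phi : beta) : exists G : set_system X, ProperFilter G /\
  beta_unit @ G --> phi.
Proof.
have [G [PG cG]] := char_limit phi; exists G; split => //.
apply: beta_cvg => g Hg.
have -> : (fun psi : beta => sval psi g) @ (beta_unit @ G) =
    (g : X -> Cplx R) @ G.
  rewrite -[LHS]/((fun y => sval (beta_unit y) g) @ G).
  by under eq_fun do rewrite beta_unitE//.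
exact: cG.
Qed.

(** Both maps have the same limit along a filter on [X] whose image converges to [phi]. The
    uniqueness in the theorem comes from here. *)
Lemma beta_unit_epi (Y : topologicalType) (a b : beta -> Y) :
  hausdorff_space Y -> continuous a -> continuous b ->
  a \o beta_unit = b \o beta_unit -> a = b.
Proof.
move=> hY ca cb ab; apply/funext => phi.
have [G [PG cG]] := beta_unit_dense phi.
have la : (a \o beta_unit) @ G --> a phi by apply: cvg_comp cG (ca phi).
have lb : (b \o beta_unit) @ G --> b phi by apply: cvg_comp cG (cb phi).
by apply: (cvg_unique hY la); rewrite ab.
Qed.

(** * Extension of [B]-maps to the spectrum *)

(** The preimage of a compact closed neighbourhood is again one. This makes Urysohn functions
    available on [Y]. *)
Lemma proper_locally_compact (Y : topologicalType) (s : Y -> B) :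
  hausdorff_space Y -> continuous s -> proper_map s ->
  locally_compact [set: Y].
Proof.
move=> hY cs ps y _; have [L] := lB (s y) I.
rewrite withinET => nL [cL clL]; exists (s @^-1` L).
  by rewrite withinET; exact: cs.
by split; [exact: ps|apply: (@closed_comp Y B s L) => // z _; exact: cs].
Qed.

Section Extension.
Context (Y : topologicalType) (s : Y -> B).
Context (hY : hausdorff_space Y) (cs : continuous s) (ps : proper_map s).
Context (f : X -> Y) (cf : continuous f) (sf : s \o f = r).

Lemma extension_point (phi : beta) : exists y : Y,
  forall k, Cb R Y k -> C0 R Y k -> k y = sval phi (k \o f).
Proof.
have [e He e1] := char_local_unit phi.
have [G [PG cG]] := char_limit phi.
have [K cK eK] : exists2 K, compact K & forall x, ~ K (r x) -> `|e x| <= 2^-1.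
  by have /(HXP _ _ _ _ _ hB lB cr)[_ ve] := He; apply: ve; rewrite invr_gt0.
(* Along [G] the function [e] tends to 1, while [|e|] is at most 1/2 off the preimage of [K]; so the
   image filter lies over [K]. *)
have GK : (f @ G) (s @^-1` K).
  move/(@cvgrPdist_lt _ (R[i])^o): (cG e He); rewrite e1 => /(_ 2^-1).
  rewrite invr_gt0 ltr0n => /(_ isT) G2.
  apply: (@filterS _ G) G2 => x /= ex; apply: contrapT => nK.
  have {}nK : ~ K (r x) by rewrite -sf.
  have : (1 : Cnum R) < 1; last by rewrite ltxx.
  rewrite -[X in X < _](@normr1 (Cnum R)) -[X in `|X| < _](subrK (e x)).
  apply: le_lt_trans (ler_normD _ _) _.
  by rewrite [ltRHS](splitr 1) mul1r ltr_leD// eK.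
have [y [_ cly]] := ps _ cK _ _ GK.
exists y => k Ck C0k.
(* [k y] is a cluster value of [k] along [f @ G], while [k o f] converges along [G] to
   [phi (k o f)]; in a Hausdorff space the two agree. *)
apply: (@Cplx_hausdorff R) => U V kU kV.
have Hk : H (k \o f) by exact: (@HX_comp Y s f k).
have nU : nbhs y ((k : Y -> Cplx R) @^-1` U) by case: Ck => [ck _]; exact: (ck y).
have GV : (f @ G) ((k : Y -> Cplx R) @^-1` V) by exact: (cG _ Hk).
by have [z [Vz Uz]] := cly _ _ GV nU; exists (k z).
Qed.

(** Such [k] reduce the continuity of the extension and its values on the image of [X] to the
    identity [k y = phi (k o f)]. *)
Lemma C0_point_separation (y : Y) (U : set Y) : nbhs y U -> exists k : Y -> C,
  [/\ Cb R Y k, C0 R Y k, k y = 1 & forall z, ~ U z -> k z = 0].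
Proof.
move=> /nbhs_interior nU.
have lY := proper_locally_compact Y s hY cs ps.
have [|k [Ck C0k _ k1 k0]] :=
    C0_urysohn R Y [set y] U° hY lY (@compact_set1 _ _) (open_interior U).
  by move=> _ ->; exact: nbhs_singleton.
exists k; split => //; first exact: k1.
by move=> z nz; apply: k0 => /interior_subset.
Qed.

Lemma beta_extension : exists f' : beta -> Y,
  continuous f' /\ f' \o beta_unit = f.
Proof.
have [f' f'k] := choice extension_point.
exists f'; split.
  move=> phi U /C0_point_separation[k [Ck C0k k1 k0]].
  (* The condition [psi (k o f) != 0] is open in [psi] and puts [f' psi] in [U], because [k]
     vanishes off [U]. *)
  have n0 : nbhs (sval phi (k \o f) : Cplx R) [set z | z != 0].
    apply: open_nbhs_nbhs; split; last by rewrite /= -f'k// k1 oner_eq0.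
    have -> : [set z : Cplx R | z != 0] = ~` [set 0].
      by apply/seteqP; split => z /eqP.
    apply: closed_openC; apply: compact_closed; first exact: Cplx_hausdorff.
    exact: compact_set1.
  have nphi : nbhs phi [set psi : beta | sval psi (k \o f) != 0].
    exact: beta_eval_continuous n0.
  apply: (@filterS _ (nbhs phi) _ _ (f' @^-1` U) _ nphi) => psi /=.
  rewrite -f'k// => kpsi; apply: contrapT => nU.
  by move: kpsi; rewrite k0// eqxx.
apply/funext => x; apply: hY => U V nU nV; apply: contrapT => UV.
(* If [f x] were outside [U], then [k] would be 1 at [f' (beta_unit x)] and 0 at [f x], yet these
   two values coincide. *)
have [k [Ck C0k k1 k0]] := C0_point_separation _ _ nU.
have Hk : H (k \o f) by exact: (@HX_comp Y s f k).
have := f'k (beta_unit x) _ Ck C0k.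
rewrite beta_unitE// k1 /= k0 => [/eqP|]; first by rewrite oner_eq0.
by move=> Ufx; apply: UV; exists (f x); split => //; exact: nbhs_singleton.
Qed.

End Extension.

(** * Properness of the anchor map *)

Lemma beta_anchor_proper (rho : beta -> B) :
  continuous rho -> rho \o beta_unit = r -> proper_map rho.
Proof.
move=> crho rhor K cK.
have [h [Cbh C0h _ h1 _]] :=
  C0_urysohn R B K setT hB lB cK openT (fun _ _ => I).
have Hh : H (h \o r).
  by apply: (@HX_comp B id r h) => //; first by move=> b; exact: cvg_id.
(* Both sides are continuous in [phi] and agree on the dense image of [X]. *)
have hrho (phi : beta) : sval phi (h \o r) = h (rho phi).
  have : (fun psi : beta => sval psi (h \o r) : Cplx R) =
      (h : B -> Cplx R) \o rho.
    apply: beta_unit_epi; first exact: Cplx_hausdorff.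
    - exact: beta_eval_continuous.
    - move=> psi; apply: (@continuous_comp beta B (Cplx R) rho h).
        exact: crho.
      by case: C0h => ch _; exact: ch.
    - by apply/funext => x; rewrite /= asboolT//; move/(congr1 (fun u => u x)): rhor => /= ->.
  by move=> /(congr1 (fun u => u phi)).
rewrite compact_ultra => F UF FK.
have [p pP] : {p : (X -> C) -> C & forall g, H g ->
    (fun psi : beta => sval psi g : Cplx R) @ F --> (p g : Cplx R)}.
  apply: (@choice _ _ (fun g l => H g ->
    (fun psi : beta => sval psi g : Cplx R) @ F --> (l : Cplx R))) => g.
  have [Hg|nHg] := pselect (H g); last by exists 0.
  have [_ [M gM]] := HX_Cb _ Hg.
  have [D [cD DM]] := Cplx_disc_compact R M.
  (* Each [psi g] is a limit of values of [g], hence lies in the closed set [D]. *)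
  have FD : ((fun psi : beta => sval psi g : Cplx R) @ F) D.
    apply: (@filterE _ F _
      ((fun psi : beta => (sval psi g : Cplx R)) @^-1` D)) => psi /=.
    have [G [PG cG]] := char_limit psi.
    have clD : closed D by apply: compact_closed => //; exact: Cplx_hausdorff.
    apply: (closed_cvg D clD _ _ (cG _ Hg)).
    by apply: nearW => x; exact: DM.
  have := cD; rewrite compact_ultra => /(_ _ (fmap_ultra _ _ _ _ UF) FD)[l [_ Fl]].
  by exists l.
(* Off [H_X] the limit [p] is unspecified; [is_char] demands 0 there. *)
pose p' g := if `[< H g >] then p g else 0.
have cp : is_char R X B r p'.
  split.
  - move=> a g k Hg Hk; rewrite /p' !asboolT//; last first.
      by apply: HXD => //; exact: HXZ.
    have Hl : H (fun x => a * g x + k x) by apply: HXD => //; exact: HXZ.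
    apply: (cvg_unique (@Cplx_hausdorff R) (pP _ Hl)).
    have -> : (fun psi : beta => sval psi (fun x => a * g x + k x) : Cplx R) =
        (fun psi : beta => a * sval psi g + sval psi k).
      by apply/funext => psi; have [lin _ _ _] := svalP psi; exact: lin.
    apply: (@cvgD _ (R[i])^o _ F _ _ _ _ _ _ (pP k Hk)).
    by apply: (@cvgM (R[i])^o _ F _ _ _ _ _ _ (pP g Hg)); exact: cvg_cst.
  - move=> g k Hg Hk; have Hl := HXM _ _ (HX_Cb _ Hg) Hk.
    rewrite /p' !asboolT//; apply: (cvg_unique (@Cplx_hausdorff R) (pP _ Hl)).
    have -> : (fun psi : beta => sval psi (fun x => g x * k x) : Cplx R) =
        (fun psi : beta => sval psi g * sval psi k).
      by apply/funext => psi; have [_ mul _ _] := svalP psi; exact: mul.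
    by apply: (@cvgM (R[i])^o _ F _ _ _ _ _ (pP g Hg) (pP k Hk)).
  (* Every character over [K] takes the value 1 at [h o r], so the limit functional cannot be
     zero. *)
  - exists (h \o r) => //; rewrite /p' asboolT//.
    have -> : p (h \o r) = 1; last exact: oner_neq0.
    apply: (cvg_unique (@Cplx_hausdorff R) (pP _ Hh)).
    apply: (@cvg_near_cst _ (Cplx R) 1 _ F).
    by apply: (@filterS _ F _ _ _ _ FK) => psi /= Kpsi; rewrite hrho h1.
  - by move=> g nHg; rewrite /p' asboolF.
pose phi : beta := exist _ p' cp.
have Fphi : F --> phi.
  by apply: beta_cvg => g Hg; rewrite /= /p' asboolT//; exact: pP.
exists phi; split => //=.
have clK : closed K by exact: compact_closed.
apply: (@closed_cvg _ _ F _ rho K clK FK).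
by apply: cvg_comp Fphi (crho phi).
Qed.

End RelativeBeta.

Theorem theorem4p11 (R : realType) (B : topologicalType)
  (hausB : hausdorff_space B) (lcB : locally_compact [set: B])
  (X : topologicalType) (r : X -> B) (r_cont : continuous r) :
  hausdorff_space (betaB R X B r) /\
  exists i : X -> betaB R X B r,
    (forall x g, HX R X B r g -> sval (i x) g = g x) /\
    (exists rho : betaB R X B r -> B, continuous rho /\ rho \o i = r) /\
    forall rho : betaB R X B r -> B, continuous rho -> rho \o i = r ->
      [/\ proper_map rho,
          continuous i &
          forall (X' : topologicalType) (r' : X' -> B),
            hausdorff_space X' -> continuous r' -> proper_map r' ->
            forall f : X -> X', continuous f -> r' \o f = r ->
              exists! f' : betaB R X B r -> X',
                [/\ continuous f', r' \o f' = rho & f' \o i = f]].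
Proof.
split; first exact: beta_hausdorff.
exists (beta_unit R B X r hausB lcB r_cont); split.
  by move=> x g; exact: beta_unitE.
split.
  (* The anchor map is the extension of [r] to [B], a proper [B]-space under the identity. *)
  apply: (@beta_extension R B X r hausB lcB r_cont B id) => //.
  by move=> b; exact: cvg_id.
move=> rho crho rhoi; split.
- exact: beta_anchor_proper.
- exact: beta_unit_continuous.
move=> Y s hY cs ps f cf sf.
have [f' [cf' f'i]] :=
  beta_extension R B X r hausB lcB r_cont Y s hY cs ps f cf sf.
exists f'; split.
  (* [s \o f'] and [rho] both give [r] when composed with the canonical map, so density makes them
     equal. *)
  split => //; apply: (beta_unit_epi R B X r hausB lcB r_cont) => //.
    by move=> phi; apply: continuous_comp; [exact: cf'|exact: cs].
  by rewrite rhoi -[LHS]/(s \o (f' \o _)) f'i.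
move=> g [cg _ gi].
by apply: (beta_unit_epi R B X r hausB lcB r_cont) => //; rewrite f'i gi.
Qed.
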